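(* Let $p>3$ be a prime number. Then $$\sum_{k=0}^{p-1}(-1)^k\,k\,H_k\equiv\frac{1}{2}\,H'_{p-1}\pmod p .$$
   Context: $H_k=\sum_{j=1}^{k}\frac1j$ denotes the $k$-th harmonic number, with $H_0:=0$. For an odd prime $p$, $H'_{p-1}:=1+\frac13+\frac15+\dots+\frac1{p-2}$ is the sum of the reciprocals of the odd integers between $1$ and $p-2$. Congruences modulo $p$ are between rational numbers whose denominators are prime to $p$ (i.e. congruences in the localization $\mathbb{Z}_{(p)}$). *)

(* Defs.v *)
From mathcomp Require Import all_boot all_order all_algebra.

Set Implicit Arguments.
Unset Strict Implicit.
Unset Printing Implicit Defensive.

Import Order.TTheory GRing.Theory Num.Theory.

Local Open Scope ring_scope.

Definition harmonic (k : nat) : rat := \sum_(1 <= j < k.+1) (j%:R)^-1.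

(* For even n, this is H'_n = 1 + 1/3 + 1/5 + ... + 1/(n - 1); at n = p - 1,
   with p an odd prime, the last term is 1/(p - 2). *)
Definition odd_harmonic (n : nat) : rat := \sum_(1 <= j < n | odd j) (j%:R)^-1.

(* Membership in Z_(p); [denq x] is the denominator of x in lowest terms. *)
Definition in_localization (p : nat) (x : rat) : bool := coprimez (denq x) p%:Z.

(* Congruence modulo the ideal p Z_(p). Both sides are required to lie in
   Z_(p), so the relation is false if either denominator is divisible by p. *)
Definition eqmod_loc (p : nat) (x y : rat) : Prop :=
  [/\ in_localization p x, in_localization p y
    & exists2 z : rat, in_localization p z & x - y = p%:R * z].

(* Main.v *)
(* For odd p, summation by parts gives the exact identity
     sum_{k<p} (-1)^k k H_k = (p/2) H_{p-1} - (1/2) sum_{0<j<p, j even} 1/j.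
   The reflection j = p - i turns the even j into the odd i, and
   1/i + 1/(p-i) = p / (i (p-i)), so that the sum differs from H'_{p-1}/2 by p
   times an element of Z_(p). *)
Require Import Defs.
From mathcomp Require Import all_boot all_order all_algebra.
From mathcomp Require Import ring zify.

Import GRing.Theory Num.Theory.

Local Open Scope ring_scope.

Section Localization.

Variable p : nat.

(** Any denominator prime to [p] will do, reduced or not, since the reduced one divides it. Closure
    under sums and products then only needs products of denominators. *)
Lemma in_localizationP (x : rat) :
  reflect (exists2 d : int, coprimez d p%:Z & exists c : int, d%:~R * x = c%:~R)
          (in_localization p x).
Proof.
apply: (iffP idP) => [xp | [d dp [c dx]]].
  by exists (denq x) => //; exists (numq x); rewrite numqE mulrC.
have cop : coprimez (denq x) (numq x).
  by rewrite coprimez_sym /coprimez /gcdz; exact: coprime_num_den.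
(* Clearing denominators gives [d * numq x = c * denq x], so Gauss's lemma applies. *)
have /dvdzP[q dq] : (denq x %| d)%Z.
  rewrite -(Gauss_dvdzl d cop); apply/dvdzP; exists c; apply: (@intr_inj rat).
  by rewrite !intrM -dx numqE mulrA.
by move: dp; rewrite dq coprimezMl => /andP[].
Qed.

Lemma in_localizationD (x y : rat) :
  in_localization p x -> in_localization p y -> in_localization p (x + y).
Proof.
move=> /in_localizationP[d dp [a da]] /in_localizationP[e ep [b eb]].
apply/in_localizationP; exists (d * e); first by rewrite coprimezMl dp.
exists (a * e + d * b); rewrite !(rmorphD, rmorphM) /= -da -eb; ring.
Qed.

Lemma in_localizationM (x y : rat) :
  in_localization p x -> in_localization p y -> in_localization p (x * y).
Proof.
move=> /in_localizationP[d dp [a da]] /in_localizationP[e ep [b eb]].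
apply/in_localizationP; exists (d * e); first by rewrite coprimezMl dp.
exists (a * b); rewrite !rmorphM /= -da -eb; ring.
Qed.

Lemma in_localization_int (c : int) : in_localization p c%:~R.
Proof. by rewrite /in_localization denq_int /coprimez gcd1z. Qed.

Lemma in_localizationN (x : rat) : in_localization p x -> in_localization p (- x).
Proof.
move=> xp; rewrite -mulN1r; apply: in_localizationM => //.
exact: (in_localization_int (-1)).
Qed.

(** The premise [i \in r] supplies the index bounds that keep denominators between 0 and [p]. *)
Lemma in_localization_sum (I : eqType) (r : seq I) (P : pred I) (F : I -> rat) :
  (forall i, i \in r -> P i -> in_localization p (F i)) ->
  in_localization p (\sum_(i <- r | P i) F i).
Proof.
move=> Fp; rewrite big_seq_cond; apply: (big_ind (in_localization p)) => [||i /andP[]].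
- exact: (in_localization_int 0).
- exact: in_localizationD.
- exact: Fp.
Qed.

Lemma in_localizationV (n : nat) :
  prime p -> (0 < n < p)%N -> in_localization p n%:R^-1.
Proof.
move=> p_prime /andP[n_gt0 n_lt_p]; apply/in_localizationP; exists n%:Z.
  rewrite coprimez_sym; change (coprime p n); rewrite prime_coprime //.
  by rewrite gtnNdvd.
by exists 1; rewrite pmulrn mulfV // intr_eq0; case: n n_gt0 {n_lt_p}.
Qed.

Lemma in_localization_harmonic (n : nat) :
  prime p -> (n < p)%N -> in_localization p (harmonic n).
Proof.
move=> p_prime n_lt_p; apply: in_localization_sum => j.
by rewrite mem_index_iota => jn _; apply: in_localizationV => //; lia.
Qed.

Lemma in_localization_odd_harmonic (n : nat) :
  prime p -> (n < p)%N -> in_localization p (odd_harmonic n).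
Proof.
move=> p_prime n_lt_p; apply: in_localization_sum => j.
by rewrite mem_index_iota => jn _; apply: in_localizationV => //; lia.
Qed.

End Localization.

Lemma eqmod_locD (p : nat) (y z : rat) :
  in_localization p y -> in_localization p z ->
  eqmod_loc p (y + p%:R * z) y.
Proof.
move=> yp zp; split=> //; last by exists z => //; ring.
apply: in_localizationD => //; apply: in_localizationM => //.
exact: (in_localization_int p p%:Z).
Qed.

Lemma harmonicS (n : nat) : harmonic n.+1 = harmonic n + n.+1%:R^-1.
Proof. by rewrite /harmonic big_nat_recr. Qed.

Lemma odd_harmonic_double (m : nat) :
  odd_harmonic m.*2 = \sum_(0 <= i < m) (i.*2.+1%:R)^-1.
Proof.
elim: m => [|m IHm]; first by rewrite /odd_harmonic !big_geq.
rewrite big_nat_recr //= -IHm /odd_harmonic.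
(* The first step adds only the index 1; each later one adds an even index, contributing 0, and an
   odd one. *)
case: m {IHm} => [|m]; first by rewrite !big_mkcond /= big_nat1 big_geq.
rewrite [in LHS]big_mkcond [in LHS]doubleS big_nat_recr //= big_nat_recr //=.
by rewrite odd_double addr0 [in RHS]big_mkcond.
Qed.

(** Induction by pairs of terms: with n = 2m, adding the indices n+1 and n+2 makes both sides grow
    by H_n + (n+2)/(n+1). *)
Lemma sum_sign_mul_harmonic (m : nat) :
  \sum_(0 <= k < m.*2.+1) (-1) ^+ k * k%:R * harmonic k
  = m.*2.+1%:R / 2 * harmonic m.*2
    - \sum_(0 <= i < m) (i.*2.+2%:R)^-1 / 2 :> rat.
Proof.
elim: m => [|m IHm].
  by rewrite big_nat1 /harmonic !big_geq // !mulr0 subr0.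
rewrite doubleS big_nat_recr //= big_nat_recr //= IHm big_nat_recr //=.
rewrite !harmonicS !exprS.
rewrite -signr_odd odd_double /= expr0.
have a0 : m.*2.+1%:R != 0 :> rat by rewrite pnatr_eq0.
have b0 : m.*2.+2%:R != 0 :> rat by rewrite pnatr_eq0.
move: a0 b0; rewrite -(addn3 m.*2) -(addn2 m.*2) -(addn1 m.*2) !natrD => a0 b0.
by field; rewrite a0 b0.
Qed.

(** Reversing the order puts the even number 2(m-i) at the same index as the odd number 2i+1; the
    two add up to 2m+1, which will be [p]. *)
Lemma sum_even_reflect (m : nat) :
  \sum_(0 <= i < m) (i.*2.+2%:R)^-1
  = \sum_(0 <= i < m) ((m - i).*2%:R)^-1 :> rat.
Proof.
rewrite big_nat_rev big_seq [RHS]big_seq; apply: eq_bigr => i.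
by rewrite mem_index_iota => im; congr (_%:R^-1); lia.
Qed.

Theorem theorem1 (p : nat) (p_prime : prime p) (p_gt3 : (3 < p)%N) :
  eqmod_loc p (\sum_(0 <= k < p) (-1) ^+ k * k%:R * harmonic k)
              (1 / 2%:R * odd_harmonic p.-1).
Proof.
have [m def_p] : exists m, p = m.*2.+1.
  exists p./2; have := odd_double_half p.
  by case: (even_prime p_prime) => [p2|->]; [move: p_gt3; rewrite p2 | lia].
(* [T] is the sum of 1/(j(p-j)) over the odd j = 2i+1 below [p]. *)
pose T : rat := \sum_(0 <= i < m) (i.*2.+1%:R)^-1 * ((m - i).*2%:R)^-1.
have pT : p%:R * T = odd_harmonic p.-1 + \sum_(0 <= i < m) ((m - i).*2%:R)^-1.
  rewrite def_p odd_harmonic_double -big_split /= mulr_sumr.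
  rewrite big_seq [RHS]big_seq; apply: eq_bigr => i.
  rewrite mem_index_iota => im.
  have -> : m.*2.+1 = (i.*2.+1 + (m - i).*2)%N by lia.
  have a0 : i.*2.+1%:R != 0 :> rat by rewrite pnatr_eq0.
  have b0 : (m - i).*2%:R != 0 :> rat by rewrite pnatr_eq0; lia.
  rewrite natrD; field.
  by rewrite b0 addrC natr1.
(* Writing the even sum as p T - H'_{p-1} turns the congruence into an equality in the rationals,
   with an explicit cofactor of [p]; only membership in Z_(p) then remains. *)
have -> : \sum_(0 <= k < p) (-1) ^+ k * k%:R * harmonic k
    = 1 / 2%:R * odd_harmonic p.-1 + p%:R * (2%:R^-1 * (harmonic p.-1 - T)).
  rewrite {1}def_p sum_sign_mul_harmonic -mulr_suml sum_even_reflect.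
  by rewrite mulrCA mulrBr pT def_p /=; field.
have half : in_localization p 2%:R^-1 by apply: in_localizationV => //; lia.
apply: eqmod_locD.
  rewrite div1r; apply: in_localizationM => //.
  by apply: in_localization_odd_harmonic => //; lia.
apply: in_localizationM => //; apply: in_localizationD.
  by apply: in_localization_harmonic => //; lia.
apply: in_localizationN; apply: in_localization_sum => i.
rewrite mem_index_iota => im _.
by apply: in_localizationM; apply: in_localizationV => //; lia.
Qed.
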